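(* In the standing setting below, assume $A$ has full column rank. Let $Q_1,Q_2,\dots$ be i.i.d. Haar-distributed elements of $\mathrm{SO}(d+1)$, and for each $T\in\mathbb{N}$ let $P_A^{(T)}=\sum_j(\beta^{(T)}_{\mathrm{aug}})_j\varphi_j$, where $\beta^{(T)}_{\mathrm{aug}}$ minimises $L_{\mathrm{aug}}$ with augmentation parameters $(T^{-1},Q_t)_{t=1}^T$. Then for every $\epsilon>0$, $$\frac{\varepsilon_{\mathrm{sym}}(P_A^{(T)})\sqrt T}{(\ln T)^{1/2+\epsilon}}\longrightarrow0\quad\text{almost surely as }T\to\infty.$$
   Context: $S^{N,d}=(S^d)^N$ with $L^2$ taken w.r.t. the product of normalised uniform surface measures; $Q\in\mathrm{SO}(d+1)$ acts elementwise, $Q\cdot(\mathbf r_1,\dots,\mathbf r_N)=(Q\mathbf r_1,\dots,Q\mathbf r_N)$. $V^{N,d}_K$: restrictions to $S^{N,d}$ of complex polynomials of total degree $\le K$ in Cartesian coordinates; $B^{N,d}_K$: its rotation-invariant subspace. Fix an orthonormal basis $\varphi_1,\dots,\varphi_m$ of $V^{N,d}_K$ with $\varphi_1,\dots,\varphi_{m_{\mathrm I}}$ a basis of $B^{N,d}_K$ and the rest a basis of its orthogonal complement. Fixed data: points $R_1,\dots,R_n\in S^{N,d}$, a rotation-invariant target $f$, $Y_i=f(R_i)$; design matrix $A_{ij}=\varphi_j(R_i)$; $(A\circ Q)_{ij}=\varphi_j(Q\cdot R_i)$. For weights $w_t$ and rotations $Q_t$, $L_{\mathrm{aug}}(\beta)=\frac12\sum_{t=1}^Tw_t\|(A\circ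 Q_t)\beta-Y\|^2$. $\varepsilon_{\mathrm{sym}}(g)=\|g-\mathrm{sym}(g)\|_{L^2}$, $\mathrm{sym}$ the $L^2$-orthogonal projection onto rotation-invariant functions. *)

(* Defs.v *)
(* MathComp + MathComp-Analysis (R : realType), complex numbers R[i]
   from mathcomp-real-closed. *)
From HB Require Import structures.
From mathcomp Require Import all_boot all_order all_algebra.
From mathcomp Require Import all_classical all_reals all_analysis.
From mathcomp Require Import complex.
Import Order.TTheory GRing.Theory Num.Theory.
Import numFieldNormedType.Exports.

Set Implicit Arguments.
Unset Strict Implicit.
Unset Printing Implicit Defensive.

Local Open Scope ring_scope.
Local Open Scope classical_set_scope.

Section Defs.
Variable R : realType.

(* ---------- rotations ---------- *)
(* Q in SO(n) *)
Definition isSO (n : nat) (Q : 'M[R]_n) : Prop :=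
  Q^T *m Q = 1%:M /\ \det Q = 1.

(* ---------- configuration space (R^{d+1})^N ----------
   A configuration X : 'M[R]_(N, d.+1) has as i-th row the point r_i. *)
Definition onS (N d : nat) (X : 'M[R]_(N, d.+1)) : Prop :=
  forall i : 'I_N, \sum_(k < d.+1) X i k ^+ 2 = 1.

(* elementwise action Q . (r_1,..,r_N) = (Q r_1, ..., Q r_N) *)
Definition rot (N d : nat) (Q : 'M[R]_(d.+1)) (X : 'M[R]_(N, d.+1))
  : 'M[R]_(N, d.+1) := X *m Q^T.

(* rotation invariance of a function on S^{N,d} *)
Definition rot_invariant (N d : nat) (g : 'M[R]_(N, d.+1) -> R[i]) : Prop :=
  forall Q X, isSO Q -> onS X -> g (rot Q X) = g X.

(* ---------- polynomial space V^{N,d}_K ---------- *)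
Definition mono_deg (N d K : nat) (a : {ffun 'I_N * 'I_d.+1 -> 'I_K.+1}) : nat :=
  (\sum_(p : 'I_N * 'I_d.+1) (a p : nat))%N.

Definition monomial (N d K : nat) (a : {ffun 'I_N * 'I_d.+1 -> 'I_K.+1})
  (X : 'M[R]_(N, d.+1)) : R[i] :=
  \prod_(p : 'I_N * 'I_d.+1) ((X p.1 p.2)%:C)%C ^+ (a p : nat).

(* g is (the restriction to S^{N,d} of) a complex polynomial of total degree
   <= K in the Cartesian coordinates *)
Definition inV (N d K : nat) (g : 'M[R]_(N, d.+1) -> R[i]) : Prop :=
  exists c : {ffun {ffun 'I_N * 'I_d.+1 -> 'I_K.+1} -> R[i]},
    forall X, onS X ->
      g X = \sum_(a | (mono_deg a <= K)%N) c a * monomial a X.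

(* ---------- normalised uniform measure on S^{N,d} ----------
   Iterated Lebesgue integral over the cube [-1,1]^n. *)
Definition vcons (x : R) (v : nat -> R) : nat -> R :=
  fun k => if k is k'.+1 then v k' else x.

Fixpoint iint (n : nat) (F : (nat -> R) -> \bar R) : \bar R :=
  match n with
  | 0 => F (fun _ => 0)
  | n'.+1 => (\int[@lebesgue_measure R]_(x in `[(-1)%R, 1%R])
                iint n' (fun v => F (vcons x v)))%E
  end.

(* squared norm of the i-th block (of size d+1) of v *)
Definition blocksq (N d : nat) (v : nat -> R) (i : 'I_N) : R :=
  \sum_(k < d.+1) v (i * d.+1 + k)%N ^+ 2.

Definition blockOK (N d : nat) (v : nat -> R) : bool :=
  [forall i : 'I_N, (0 < blocksq d v i) && (blocksq d v i <= 1)].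

(* blockwise radial projection onto S^{N,d} *)
Definition nmat (N d : nat) (v : nat -> R) : 'M[R]_(N, d.+1) :=
  \matrix_(i < N, k < d.+1) (v (i * d.+1 + k)%N / Num.sqrt (blocksq d v i)).

(* Integral over S^{N,d} w.r.t. the product of the normalised uniform
   surface measures, via the cone-measure identity: if U is uniform on the
   unit ball B^{d+1}, then U/|U| is uniform on S^d. *)
Definition sphInt (N d : nat) (F : 'M[R]_(N, d.+1) -> R) : R :=
  fine (iint (N * d.+1)
          (fun v => (if blockOK N d v then F (nmat N d v) else 0)%:E))
  / fine (iint (N * d.+1)
          (fun v => (if blockOK N d v then 1 else 0)%:E)).

Definition cabs2 (z : R[i]) : R := complex.Re z ^+ 2 + complex.Im z ^+ 2.

(* L^2 inner product <f, g> = int f * conj g *)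
Definition ip (N d : nat) (f g : 'M[R]_(N, d.+1) -> R[i]) : R[i] :=
  Complex (sphInt (fun X => complex.Re (f X * (g X)^*)%C))
          (sphInt (fun X => complex.Im (f X * (g X)^*)%C)).

Definition L2sq (N d : nat) (f : 'M[R]_(N, d.+1) -> R[i]) : R :=
  sphInt (fun X => cabs2 (f X)).

(* eps_sym(g) = || g - sym g ||_{L^2} = distance in L^2 from g to the
   (closed) subspace of rotation-invariant functions; continuous invariant
   functions are dense in that subspace. *)
Definition eps_sym (N d : nat) (g : 'M[R]_(N, d.+1) -> R[i]) : R :=
  Num.sqrt (inf [set L2sq (fun X => g X - h X) | h in
    [set h : 'M[R]_(N, d.+1) -> R[i] |
       rot_invariant h /\ continuous (fun X => complex.Re (h X))
                       /\ continuous (fun X => complex.Im (h X))]]).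

(* ---------- regression ---------- *)
(* (A o Q)_{ij} = phi_j (Q . R_i) *)
Definition designQ (N d n m : nat) (phi : 'I_m -> 'M[R]_(N, d.+1) -> R[i])
  (Rpts : 'I_n -> 'M[R]_(N, d.+1)) (Q : 'M[R]_(d.+1)) : 'M[R[i]]_(n, m) :=
  \matrix_(i < n, j < m) phi j (rot Q (Rpts i)).

Definition cnorm2 (n : nat) (v : 'cV[R[i]]_n) : R :=
  \sum_(i < n) cabs2 (v i 0).

(* L_aug(beta) = 1/2 sum_{t=1}^T w_t ||(A o Q_t) beta - Y||^2 *)
Definition Laug (N d n m T : nat) (phi : 'I_m -> 'M[R]_(N, d.+1) -> R[i])
  (Rpts : 'I_n -> 'M[R]_(N, d.+1)) (Y : 'cV[R[i]]_n)
  (w : 'I_T -> R) (Qs : 'I_T -> 'M[R]_(d.+1)) (beta : 'cV[R[i]]_m) : R :=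
  2^-1 * \sum_(t < T) w t * cnorm2 (designQ phi Rpts (Qs t) *m beta - Y).

End Defs.

(* Main.v *)
(** Let [A(U)] be the design matrix of the points rotated by [U]. Since the
    polynomial space is rotation stable, [A(UV) = A(V) W(U)] with
    [W(U) = A^+ A(U)], which is bounded on SO but need not be unitary for the
    argument. The mean [Pi] of [W] over a left-invariant law also equals the
    mean of [W(Q^T)], hence projects onto the invariant coefficient vectors.
    Let [b0] be the least-squares fit of the data among invariant vectors, with
    residual [r]. Then [A(Q_t) b0 - Y = r] for every [t], and the normal
    equation says that [r^* A(Q_t)] is centred. Expanding the augmented loss
    around [b0], whose quadratic part is uniformly coercive because [A] has full
    column rank, bounds the distance from the minimiser to [b0] by a constant
    times the averages of the bounded centred variables [r^* A(Q_t)]. A Chernoff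
    bound and Borel-Cantelli make these O(sqrt (ln T / T)) almost surely.
    Finally [eps_sym] is at most a constant times that distance, as [b0]
    represents an invariant polynomial. *)
Require Import Defs.
From HB Require Import structures.
From mathcomp Require Import all_boot all_order all_algebra.
From mathcomp Require Import all_classical all_reals all_analysis.
From mathcomp Require Import measurable_realfun complex ring lra.
Import Order.TTheory GRing.Theory Num.Theory.
Import numFieldNormedType.Exports.
Local Open Scope ring_scope.
Local Open Scope classical_set_scope.

Set Implicit Arguments.
Unset Strict Implicit.
Unset Printing Implicit Defensive.

(** * Real and imaginary parts of complex numbers *)

Section ComplexParts.
Variable R : rcfType.
Implicit Types z t : R[i].

Lemma Re_add z t : complex.Re (z + t) = complex.Re z + complex.Re t.
Proof. by case: z t => [? ?] []. Qed.
Lemma Im_add z t : complex.Im (z + t) = complex.Im z + complex.Im t.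
Proof. by case: z t => [? ?] []. Qed.
Lemma Re_mul z t : complex.Re (z * t) =
  complex.Re z * complex.Re t - complex.Im z * complex.Im t.
Proof. by case: z t => [? ?] []. Qed.
Lemma Im_mul z t : complex.Im (z * t) =
  complex.Re z * complex.Im t + complex.Im z * complex.Re t.
Proof. by case: z t => [? ?] []. Qed.
Lemma Re_conj z : complex.Re z^*%C = complex.Re z.
Proof. by case: z. Qed.
Lemma Im_conj z : complex.Im z^*%C = - complex.Im z.
Proof. by case: z. Qed.

Lemma Re_sum (I : Type) (r : seq I) (P : pred I) (F : I -> R[i]) :
  complex.Re (\sum_(i <- r | P i) F i) = \sum_(i <- r | P i) complex.Re (F i).
Proof. exact: (big_morph _ Re_add). Qed.
Lemma Im_sum (I : Type) (r : seq I) (P : pred I) (F : I -> R[i]) :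
  complex.Im (\sum_(i <- r | P i) F i) = \sum_(i <- r | P i) complex.Im (F i).
Proof. exact: (big_morph _ Im_add). Qed.

Lemma complex_ext z t :
  complex.Re z = complex.Re t -> complex.Im z = complex.Im t -> z = t.
Proof. by case: z t => [? ?] [? ?] /= -> ->. Qed.

End ComplexParts.

(** * Polynomial functions of matrix entries *)

Section PolynomialFunctions.
Variable R : realType.

(** Polynomials are kept as functions closed under the ring operations, without coefficients or
    degree. Continuity, boundedness on the unit cube, measurability and stability under substitution
    then all follow by induction. *)
Inductive rpoly (a b : nat) : ('M[R]_(a, b) -> R) -> Prop :=
| rpoly_cst c : rpoly (fun _ => c)
| rpoly_coord i j : rpoly (fun X => X i j)
| rpoly_add f g : rpoly f -> rpoly g -> rpoly (fun X => f X + g X)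
| rpoly_mul f g : rpoly f -> rpoly g -> rpoly (fun X => f X * g X).

Definition cpoly (a b : nat) (F : 'M[R]_(a, b) -> R[i]) :=
  rpoly (fun X => complex.Re (F X)) /\ rpoly (fun X => complex.Im (F X)).

Section Closure.
Variables a b : nat.
Implicit Types (f g : 'M[R]_(a, b) -> R) (F G : 'M[R]_(a, b) -> R[i]).

Lemma rpoly_ext f g : f =1 g -> rpoly f -> rpoly g.
Proof. by move=> /funext ->. Qed.

Lemma rpoly_opp f : rpoly f -> rpoly (fun X => - f X).
Proof.
move=> hf; apply: (@rpoly_ext (fun X => (-1) * f X)) => [X|].
  by rewrite mulN1r.
by apply: rpoly_mul => //; exact: rpoly_cst.
Qed.

Lemma rpoly_sum (I : Type) (r : seq I) (P : pred I) (h : I -> 'M[R]_(a, b) -> R) :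
  (forall i, rpoly (h i)) -> rpoly (fun X => \sum_(i <- r | P i) h i X).
Proof.
move=> hh; elim: r => [|i r IH].
  by apply: (@rpoly_ext (fun=> 0)) => [X|]; [rewrite big_nil|exact: rpoly_cst].
case: (boolP (P i)) => Pi; last first.
  by apply: rpoly_ext IH => X; rewrite big_cons (negbTE Pi).
apply: (@rpoly_ext (fun X => h i X + \sum_(i <- r | P i) h i X)) => [X|].
  by rewrite big_cons Pi.
exact: rpoly_add.
Qed.

Lemma rpoly_continuous f : rpoly f -> continuous f.
Proof.
elim=> [c|i j|f1 g1 _ cf _ cg|f1 g1 _ cf _ cg] X.
- exact: cst_continuous.
- exact: coord_continuous.
- by apply: continuousD; [exact: cf|exact: cg].
- by apply: continuousM; [exact: cf|exact: cg].
Qed.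

Lemma rpoly_bounded f : rpoly f ->
  exists2 M : R, 0 < M & forall X : 'M[R]_(a, b), (forall i j, `|X i j| <= 1) -> `|f X| <= M.
Proof.
elim=> [c|i j|f1 g1 _ [M1 M10 H1] _ [M2 M20 H2]|f1 g1 _ [M1 M10 H1] _ [M2 M20 H2]].
- by exists (1 + `|c|) => [|X _]; rewrite ?ltr_pwDl ?lerDr.
- by exists 1 => // X; apply.
- exists (M1 + M2) => [|X HX]; first exact: addr_gt0.
  by rewrite (le_trans (ler_normD _ _))// lerD ?H1 ?H2.
- exists (M1 * M2) => [|X HX]; first exact: mulr_gt0.
  by rewrite normrM ler_pM ?H1 ?H2.
Qed.

Lemma rpoly_measurable f d (T : measurableType d) (Q : T -> 'M[R]_(a, b)) :
  rpoly f -> (forall i j, measurable_fun setT (fun w => Q w i j)) ->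
  measurable_fun setT (fun w => f (Q w)).
Proof.
move=> hf mQ; elim: hf => [c|i j|f1 g1 _ cf _ cg|f1 g1 _ cf _ cg].
- exact: measurable_cst.
- exact: mQ.
- exact: measurable_funD.
- exact: measurable_funM.
Qed.

Lemma rpoly_comp f (a' b' : nat) (h : 'M[R]_(a', b') -> 'M[R]_(a, b)) :
  rpoly f -> (forall i j, rpoly (fun X => h X i j)) -> rpoly (fun X => f (h X)).
Proof.
move=> hf hh; elim: hf => [c|i j|f1 g1 _ cf _ cg|f1 g1 _ cf _ cg].
- exact: rpoly_cst.
- exact: hh.
- exact: rpoly_add.
- exact: rpoly_mul.
Qed.

Lemma cpoly_ext F G : F =1 G -> cpoly F -> cpoly G.
Proof. by move=> /funext ->. Qed.

Lemma cpoly_cst z : cpoly (fun _ : 'M[R]_(a, b) => z).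
Proof. by split; exact: rpoly_cst. Qed.

Lemma cpoly_coord i j : cpoly (fun X : 'M[R]_(a, b) => (X i j)%:C%C).
Proof. by split; [exact: rpoly_coord|exact: rpoly_cst]. Qed.

Lemma cpoly_mul F G : cpoly F -> cpoly G -> cpoly (fun X => F X * G X).
Proof.
move=> [rF iF] [rG iG]; split.
  apply: (@rpoly_ext (fun X => complex.Re (F X) * complex.Re (G X) +
     - (complex.Im (F X) * complex.Im (G X)))) => [X|]; first by rewrite Re_mul.
  by apply: rpoly_add; [|apply: rpoly_opp]; exact: rpoly_mul.
apply: (@rpoly_ext (fun X => complex.Re (F X) * complex.Im (G X) +
   (complex.Im (F X) * complex.Re (G X)))) => [X|]; first by rewrite Im_mul.
by apply: rpoly_add; exact: rpoly_mul.
Qed.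

Lemma cpoly_sum (I : Type) (r : seq I) (P : pred I) (h : I -> 'M[R]_(a, b) -> R[i]) :
  (forall i, cpoly (h i)) -> cpoly (fun X => \sum_(i <- r | P i) h i X).
Proof.
move=> hh; split.
  apply: (@rpoly_ext (fun X => \sum_(i <- r | P i) complex.Re (h i X))) => [X|].
    by rewrite Re_sum.
  by apply: rpoly_sum => i; case: (hh i).
apply: (@rpoly_ext (fun X => \sum_(i <- r | P i) complex.Im (h i X))) => [X|].
  by rewrite Im_sum.
by apply: rpoly_sum => i; case: (hh i).
Qed.

Lemma cpoly_exp F k : cpoly F -> cpoly (fun X => F X ^+ k).
Proof.
move=> hF; elim: k => [|k IH].
  by apply: cpoly_ext (cpoly_cst 1) => X; rewrite expr0.
by apply: cpoly_ext (cpoly_mul hF IH) => X; rewrite exprS.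
Qed.

Lemma cpoly_prod (I : Type) (r : seq I) (h : I -> 'M[R]_(a, b) -> R[i]) :
  (forall i, cpoly (h i)) -> cpoly (fun X => \prod_(i <- r) h i X).
Proof.
move=> hh; elim: r => [|i r IH].
  by apply: cpoly_ext (cpoly_cst 1) => X; rewrite big_nil.
by apply: cpoly_ext (cpoly_mul (hh i) IH) => X; rewrite big_cons.
Qed.

Lemma cpoly_comp F (a' b' : nat) (h : 'M[R]_(a', b') -> 'M[R]_(a, b)) :
  cpoly F -> (forall i j, rpoly (fun X => h X i j)) -> cpoly (fun X => F (h X)).
Proof. by move=> [rF iF] hh; split; [exact: (rpoly_comp rF hh)|exact: (rpoly_comp iF hh)]. Qed.

End Closure.

(** * The space of polynomials of bounded degree and its stability under rotations *)

Section DegreeBound.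
Variables N d : nat.
Implicit Types (g : 'M[R]_(N, d.+1) -> R[i]) (K : nat).

Lemma inV_ext K g g' : (forall X, onS X -> g X = g' X) -> inV K g -> inV K g'.
Proof. by move=> gg' [c Hc]; exists c => X HX; rewrite -gg' ?Hc. Qed.

Lemma inV_add K g g' : inV K g -> inV K g' -> inV K (fun X => g X + g' X).
Proof.
move=> [c Hc] [c' Hc']; exists [ffun a => c a + c' a] => X HX.
rewrite Hc ?Hc'// -big_split/=; apply: eq_bigr => a _.
by rewrite ffunE mulrDl.
Qed.

Lemma inV_scale K z g : inV K g -> inV K (fun X => z * g X).
Proof.
move=> [c Hc]; exists [ffun a => z * c a] => X HX.
rewrite Hc// mulr_sumr; apply: eq_bigr => a _.
by rewrite ffunE mulrA.
Qed.

Lemma inV_sum K (I : Type) (r : seq I) (P : pred I) (h : I -> 'M[R]_(N, d.+1) -> R[i]) :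
  (forall i, P i -> inV K (h i)) -> inV K (fun X => \sum_(i <- r | P i) h i X).
Proof.
move=> hh; elim: r => [|i r IH].
  exists [ffun=> 0] => X _; rewrite big_nil big1// => a _.
  by rewrite ffunE mul0r.
case: (boolP (P i)) => Pi; last first.
  by apply: inV_ext IH => X _; rewrite big_cons (negbTE Pi).
by apply: inV_ext (inV_add (hh _ Pi) IH) => X _; rewrite big_cons Pi.
Qed.

Lemma inV_mono K (a : 'I_N * 'I_d.+1 -> nat) : (\sum_p a p <= K)%N ->
  inV K (fun X : 'M[R]_(N, d.+1) => \prod_p ((X p.1 p.2)%:C)%C ^+ a p).
Proof.
move=> aK.
(* Each exponent is at most the total degree, hence at most [K], so [inord] loses nothing. *)
have aE p : nat_of_ord (inord (a p) : 'I_K.+1) = a p.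
  by rewrite inordK// ltnS (leq_trans _ aK)// (bigD1 p)//= leq_addr.
pose a' : {ffun 'I_N * 'I_d.+1 -> 'I_K.+1} := [ffun p => inord (a p)].
exists [ffun e => (e == a')%:R] => X _.
rewrite (bigD1 a')/=; last first.
  by rewrite /mono_deg (eq_bigr a) => [//|p _]; rewrite ffunE aE.
rewrite ffunE eqxx mul1r [X in _ + X]big1 ?addr0.
  by rewrite /monomial; apply: eq_bigr => p _; rewrite ffunE aE.
by move=> e /andP[_ /negbTE ne]; rewrite ffunE ne mul0r.
Qed.

Lemma inV_mul_coord K g i j : inV K g ->
  inV K.+1 (fun X : 'M[R]_(N, d.+1) => (X i j)%:C%C * g X).
Proof.
move=> [c Hc].
apply: (@inV_ext _ (fun X => \sum_(a : {ffun 'I_N * 'I_d.+1 -> 'I_K.+1} |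
   (mono_deg a <= K)%N)
   c a * \prod_p ((X p.1 p.2)%:C)%C ^+ ((p == (i, j)) + a p))).
  move=> X HX; rewrite Hc// mulr_sumr; apply: eq_bigr => a _.
  rewrite mulrCA; congr (_ * _).
  rewrite /monomial; under eq_bigr do rewrite exprD.
  rewrite big_split/=; congr (_ * _).
  rewrite (bigD1 (i, j))//= eqxx expr1 big1 ?mulr1// => p /negbTE ->.
  by rewrite expr0.
apply: inV_sum => a Ha; apply: inV_scale; apply: inV_mono.
rewrite big_split/= (bigD1 (i, j))//= eqxx big1 => [|p /negbTE ->//].
by rewrite addn0 add1n.
Qed.

Lemma inV_mul_rot K (U : 'M[R]_d.+1) g i j : inV K g ->
  inV K.+1 (fun X : 'M[R]_(N, d.+1) => (Defs.rot U X i j)%:C%C * g X).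
Proof.
move=> hg.
apply: (@inV_ext _ (fun X => \sum_l (U j l)%:C%C * ((X i l)%:C%C * g X))).
  move=> X _; rewrite /Defs.rot mxE rmorph_sum/= mulr_suml.
  by apply: eq_bigr => l _; rewrite !mxE rmorphM/= mulrA (mulrC (X i l)%:C%C).
by apply: inV_sum => l _; apply: inV_scale; exact: inV_mul_coord.
Qed.

Lemma inV_le K K' g : (K <= K')%N -> inV K g -> inV K' g.
Proof.
move=> KK' [c Hc].
apply: (@inV_ext _ (fun X => \sum_(a : {ffun 'I_N * 'I_d.+1 -> 'I_K.+1} |
   (mono_deg a <= K)%N) c a * monomial a X)) => [X /Hc //|].
apply: inV_sum => a Ha; apply: inV_scale; apply: inV_mono.
exact: leq_trans KK'.
Qed.

Lemma onS_rot (U : 'M[R]_d.+1) (X : 'M[R]_(N, d.+1)) :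
  isSO U -> onS X -> onS (Defs.rot U X).
Proof.
move=> [UU _] HX i.
have sq (Y : 'M[R]_(N, d.+1)) : \sum_k Y i k ^+ 2 = (Y *m Y^T) i i.
  by rewrite mxE; apply: eq_bigr => k _; rewrite mxE expr2.
by rewrite sq /Defs.rot trmx_mul trmxK mulmxA -(mulmxA X) UU mulmx1 -sq HX.
Qed.

(** A rotation turns every coordinate into a linear form in the coordinates of the same point, so
    monomials keep their degree bound. *)
Lemma inV_rot K (U : 'M[R]_d.+1) g : inV K g -> isSO U -> inV K (fun X => g (Defs.rot U X)).
Proof.
move=> [c Hc] HU.
apply: (@inV_ext _ (fun X => \sum_(a : {ffun 'I_N * 'I_d.+1 -> 'I_K.+1} |
   (mono_deg a <= K)%N) c a * monomial a (Defs.rot U X))) => [X HX|].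
  by rewrite Hc//; exact: onS_rot.
apply: inV_sum => a Ha; apply: inV_scale.
(* The degree bound is lowered to the exact sum of exponents, so that the inductions over the list
   of variables and over one exponent can track it. *)
apply: (inV_le Ha); rewrite /mono_deg /monomial.
elim: (index_enum _) => [|p r IH].
  apply: (@inV_ext _ (fun X => \prod_p ((X p.1 p.2)%:C)%C ^+ 0)) => [X _|].
    by rewrite big_nil; under eq_bigr do rewrite expr0; rewrite big1.
  by apply: inV_mono; rewrite big1.
apply: (@inV_ext _ (fun X => ((Defs.rot U X p.1 p.2)%:C)%C ^+ a p *
   \prod_(p <- r) ((Defs.rot U X p.1 p.2)%:C)%C ^+ a p)) => [X _|].
  by rewrite big_cons.
rewrite big_cons; elim: (nat_of_ord (a p)) => [|k IHk].
  by apply: inV_ext IH => X _; rewrite expr0 mul1r.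
by apply: inV_ext (inV_mul_rot U p.1 p.2 IHk) => X _; rewrite exprS mulrA.
Qed.

(** Membership in [inV] constrains values on the sphere only. Regularity and bounds have to be read
    off a polynomial that agrees with [g] there. *)
Lemma inV_cpoly K g : inV K g ->
  exists2 p, cpoly p & forall X, onS X -> g X = p X.
Proof.
move=> [c Hc]; exists (fun X => \sum_(a : {ffun 'I_N * 'I_d.+1 -> 'I_K.+1} |
   (mono_deg a <= K)%N) c a * monomial a X) => //.
apply: cpoly_sum => a; apply: cpoly_mul; first exact: cpoly_cst.
by apply: cpoly_prod => p; apply: cpoly_exp; exact: cpoly_coord.
Qed.

End DegreeBound.
End PolynomialFunctions.

(** * Bounds for the sphere integral, and the symmetry defect in terms of coefficients *)

Section SphereIntegral.
Variable R : realType.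

(* [ge0_le_integral] without measurability: the integral of a nonnegative
   function is a supremum over the simple functions below it. *)
Lemma ge0_le_integral_nomeas d (T : measurableType d) (mu : {measure set T -> \bar R})
    (D : set T) (f g : T -> \bar R) :
  (forall x, D x -> (0 <= f x)%E) -> (forall x, D x -> (f x <= g x)%E) ->
  (\int[mu]_(x in D) f x <= \int[mu]_(x in D) g x)%E.
Proof.
move=> f0 fg; have g0 x : D x -> (0 <= g x)%E by move=> Dx; rewrite (le_trans (f0 _ Dx)) ?fg.
rewrite !ge0_integralE//; apply: le_ereal_sup => _ [h hf <-].
exists h => // x; rewrite (le_trans (hf x))// /patch; case: ifP => // /set_mem.
exact: fg.
Qed.

Lemma iint_ge0 n (F : (nat -> R) -> \bar R) :
  (forall v, (0 <= F v)%E) -> (0 <= iint n F)%E.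
Proof.
elim: n F => [|n IH] F HF /=; first exact: HF.
by apply: integral_ge0 => x _; exact: IH.
Qed.

Lemma sphInt_ge0 N d (F : 'M[R]_(N, d.+1) -> R) :
  (forall X, 0 <= F X) -> 0 <= sphInt F.
Proof.
move=> F0; rewrite divr_ge0// fine_ge0// iint_ge0// => v; case: ifP => //.
by rewrite lee_fin.
Qed.

(** Each of the [n] integrations runs over an interval of length 2. Monotonicity of the integral for
    arbitrary nonnegative functions lets the bound pass through the inner integrals. *)
Lemma iint_bound n (F : (nat -> R) -> \bar R) (B : R) : 0 <= B ->
  (forall v, (0 <= F v <= B%:E)%E) -> (0 <= iint n F <= (B * 2 ^+ n)%:E)%E.
Proof.
move=> B0; elim: n F => [|n IH] F HF /=; first by rewrite mulr1.
have Hn x : (0 <= iint n (fun v => F (vcons x v)) <= (B * 2 ^+ n)%:E)%E by exact: IH.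
apply/andP; split.
  by apply: integral_ge0 => x _; case/andP: (Hn x).
apply: (@le_trans _ _ (\int[@lebesgue_measure R]_(x in `[(-1)%R, 1%R]) (B * 2 ^+ n)%:E)%E).
  by apply: ge0_le_integral_nomeas => x _; case/andP: (Hn x).
have lt11 : -1 < 1 :> R by lra.
rewrite integral_cst//= lebesgue_measure_itv/= lte_fin lt11 /= -EFinB -EFinM.
by rewrite lee_fin exprSr mulrA opprK.
Qed.

Lemma onS_nmat N d (v : nat -> R) : blockOK N d v -> onS (nmat N d v).
Proof.
move=> /forallP ok i; have /andP[s0 _] := ok i.
under eq_bigr do rewrite mxE expr_div_n sqr_sqrtr ?ltW//.
by rewrite -mulr_suml divff// gt_eqF.
Qed.

(** Here [kappa] is the volume of the cube divided by the normalising integral. Only nonnegativity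
    of that integral is used: if it were 0, both sides would be 0 by the convention for division.
    Bounds on the sphere suffice because [nmat] lands there whenever the integrand is not set to
    0. *)
Lemma sphInt_bound N d : exists2 kappa : R, 0 <= kappa &
  forall (F : 'M[R]_(N, d.+1) -> R) (B : R), 0 <= B ->
    (forall X, onS X -> 0 <= F X <= B) -> 0 <= sphInt F <= B * kappa.
Proof.
pose one := fun v : nat -> R => (if blockOK N d v then 1 else 0 : R)%:E.
have fine_bound n (F : (nat -> R) -> \bar R) (B : R) : 0 <= B ->
    (forall v, (0 <= F v <= B%:E)%E) -> 0 <= fine (iint n F) <= B * 2 ^+ n.
  move=> B0 HF; have := iint_bound n B0 HF.
  by case: (iint n F) => [r| |] /andP[]; rewrite ?lee_fin// => -> ->.
have den0 : 0 <= fine (iint (N * d.+1) one).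
  apply: fine_ge0; apply: iint_ge0 => v; rewrite /one.
  by case: ifP; rewrite lee_fin.
exists (2 ^+ (N * d.+1) / fine (iint (N * d.+1) one)).
  by rewrite divr_ge0 ?exprn_ge0.
move=> F B B0 HF; rewrite /sphInt -/one mulrA.
have /andP[n0 nB] : 0 <= fine (iint (N * d.+1)
      (fun v => (if blockOK N d v then F (nmat N d v) else 0)%:E))
    <= B * 2 ^+ (N * d.+1).
  apply: fine_bound => // v; case: ifP => [/onS_nmat/HF|_]; rewrite !lee_fin//.
  by rewrite lexx B0.
by rewrite divr_ge0//= ler_wpM2r ?invr_ge0.
Qed.
Lemma sum_sqr1_le1 (I : finType) (x : I -> R) (i : I) :
  \sum_k x k ^+ 2 = 1 -> `|x i| <= 1.
Proof.
move=> x1; rewrite -(expr_le1 (n := 2))// real_normK ?num_real// -x1.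
by rewrite (bigD1 i)//= lerDl sumr_ge0// => k _; exact: sqr_ge0.
Qed.

Lemma onS_le1 N d (X : 'M[R]_(N, d.+1)) i j : onS X -> `|X i j| <= 1.
Proof. by move=> /(_ i); exact: sum_sqr1_le1. Qed.

Lemma cabs2_ge0 (z : R[i]) : 0 <= cabs2 z.
Proof. by rewrite addr_ge0 ?sqr_ge0. Qed.

Lemma cabs2M (z t : R[i]) : cabs2 (z * t) = cabs2 z * cabs2 t.
Proof. by rewrite /cabs2 Re_mul Im_mul; ring. Qed.

Lemma cnorm2_ge0 n (v : 'cV[R[i]]_n) : 0 <= cnorm2 v.
Proof. by apply: sumr_ge0 => i _; exact: cabs2_ge0. Qed.

Lemma sqr_sum_le n (x : 'I_n -> R) : (\sum_i x i) ^+ 2 <= n%:R * \sum_i x i ^+ 2.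
Proof.
have cst (c : R) : \sum_(j < n) c = n%:R * c.
  by rewrite sumr_const card_ord mulr_natl.
apply: (@le_trans _ _ (\sum_i \sum_j (x i ^+ 2 / 2 + x j ^+ 2 / 2))).
  rewrite expr2 mulr_suml; apply: ler_sum => i _.
  rewrite mulr_sumr; apply: ler_sum => j _.
  by have := sqr_ge0 (x i - x j); nra.
under eq_bigr do rewrite big_split/= cst.
by rewrite big_split/= cst -mulr_sumr -!mulr_suml -mulrDr -splitr.
Qed.

Lemma cabs2_sum_le n (z : 'I_n -> R[i]) :
  cabs2 (\sum_i z i) <= n%:R * \sum_i cabs2 (z i).
Proof.
rewrite /cabs2 Re_sum Im_sum big_split/= mulrDr.
by apply: lerD; exact: sqr_sum_le.
Qed.

Lemma cabs2_le (z : R[i]) (M : R) : `|complex.Re z| <= M -> `|complex.Im z| <= M ->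
  cabs2 z <= 2 * M ^+ 2.
Proof.
move=> rM iM; rewrite mulr_natl mulr2n /cabs2 -(real_normK (num_real (complex.Re z))).
rewrite -(real_normK (num_real (complex.Im z))).
by rewrite lerD// ler_pXn2r// nnegrE ?normr_ge0// (le_trans _ rM).
Qed.

Lemma cnorm2_mulmx_le (a b : nat) (M : 'M[R[i]]_(a, b)) (v : 'cV[R[i]]_b) (C : R) :
  (forall i j, cabs2 (M i j) <= C) ->
  cnorm2 (M *m v) <= a%:R * (b%:R * C) * cnorm2 v.
Proof.
move=> HM; apply: (@le_trans _ _ (\sum_(i < a) b%:R * C * cnorm2 v)).
  rewrite {1}/cnorm2; apply: ler_sum => i _; rewrite mxE (le_trans (cabs2_sum_le _))// -mulrA.
  rewrite ler_wpM2l// /cnorm2 [leRHS]mulr_sumr; apply: ler_sum => j _.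
  by rewrite cabs2M ler_wpM2r ?cabs2_ge0.
by rewrite sumr_const card_ord -[leLHS]mulr_natl -[leRHS]mulrA.
Qed.

Lemma cpoly_bounded (a b : nat) (F : 'M[R]_(a, b) -> R[i]) : cpoly F ->
  exists2 M : R, 0 <= M &
    forall X : 'M[R]_(a, b), (forall i j, `|X i j| <= 1) -> cabs2 (F X) <= M.
Proof.
move=> [/rpoly_bounded[M1 M10 H1] /rpoly_bounded[M2 M20 H2]].
exists (2 * (M1 + M2) ^+ 2) => [|X HX]; first by rewrite mulr_ge0 ?sqr_ge0.
apply: cabs2_le; first by rewrite (le_trans (H1 _ HX))// lerDl ltW.
by rewrite (le_trans (H2 _ HX))// lerDr ltW.
Qed.

Lemma choice_bound (I : finType) (T : Type) (A : set T) (f : I -> T -> R) :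
  (forall i, exists2 M : R, 0 <= M & forall x, A x -> f i x <= M) ->
  exists2 M : R, 0 <= M & forall i x, A x -> f i x <= M.
Proof.
move=> /(_ _)/cid2-/all_sig2[M M0 HM]; exists (\sum_i M i).
  by apply: sumr_ge0 => i _.
move=> i x Ax; rewrite (le_trans (HM _ _ Ax))// (bigD1 i)//= lerDl.
by apply: sumr_ge0.
Qed.

(** The invariant combination with coefficients [b'] competes in the infimum defining [eps_sym]. Its
    distance to the other combination is controlled by a uniform bound for the basis functions on
    the sphere. *)
Lemma eps_sym_le N d m (phi : 'I_m -> 'M[R]_(N, d.+1) -> R[i]) :
  (forall j, exists2 p, cpoly p & forall X, onS X -> phi j X = p X) ->
  exists2 C : R, 0 <= C & forall b b' : 'cV[R[i]]_m,
    rot_invariant (fun X => \sum_j b' j 0 * phi j X) ->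
    eps_sym (fun X => \sum_j b j 0 * phi j X) <= C * Num.sqrt (cnorm2 (b - b')).
Proof.
move=> /(_ _)/cid2-/all_sig2[p pp phip].
have [kappa kappa0 Hkappa] := sphInt_bound N d.
have [M M0 HM] : exists2 M : R, 0 <= M & forall j X, onS X -> cabs2 (p j X) <= M.
  apply: choice_bound => j; have [M M0 HM] := cpoly_bounded (pp j).
  by exists M => // X HX; apply: HM => i k; exact: onS_le1.
exists (Num.sqrt (m%:R * M * kappa)) => [|b b' inv]; first exact: sqrtr_ge0.
rewrite -sqrtrM ?mulr_ge0// ler_sqrt ?mulr_ge0 ?cnorm2_ge0//.
(* A competitor must be continuous on the whole matrix space, so it is built from the polynomial
   representatives [p] instead of [phi]. *)
pose h X := \sum_j b' j 0 * p j X.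
have hE X : onS X -> h X = \sum_j b' j 0 * phi j X.
  by move=> HX; apply: eq_bigr => j _; rewrite phip.
have [ch ch'] : cpoly h.
  by apply: cpoly_sum => j; apply: cpoly_mul => //; exact: cpoly_cst.
have lb : lbound [set L2sq (fun X => \sum_j b j 0 * phi j X - h X) | h in
    [set h : 'M[R]_(N, d.+1) -> R[i] |
       rot_invariant h /\ continuous (fun X => complex.Re (h X))
                       /\ continuous (fun X => complex.Im (h X))]] 0.
  by move=> _ [g _ <-]; apply: sphInt_ge0 => X; exact: cabs2_ge0.
apply: (@le_trans _ _ (L2sq (fun X => \sum_j b j 0 * phi j X - h X))).
  apply: ge_inf; first by exists 0.
  exists h => //; split; last by split; exact: rpoly_continuous.
  by move=> U X HU HX; rewrite !hE ?inv//; exact: onS_rot.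
have B0 : 0 <= m%:R * M * cnorm2 (b - b') by rewrite !mulr_ge0 ?cnorm2_ge0.
rewrite mulrAC.
suff /(Hkappa _ _ B0)/andP[] : forall X, onS X ->
  0 <= cabs2 (\sum_j b j 0 * phi j X - h X) <= m%:R * M * cnorm2 (b - b') by [].
move=> X HX; rewrite cabs2_ge0/= hE// -sumrB.
rewrite (le_trans (cabs2_sum_le _))// -mulrA ler_wpM2l// mulr_sumr.
apply: ler_sum => j _; rewrite -mulrBl cabs2M mulrC !mxE ler_wpM2r ?cabs2_ge0//.
by rewrite phip// HM.
Qed.

End SphereIntegral.

(** * Chernoff bound and Borel-Cantelli for bounded centred variables *)

Section BoundedRandomVariables.
Context {R : realType} {dO : measure_display} {Omega : measurableType dO}.
Variable P : probability Omega R.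
Implicit Types X Y : Omega -> R.

Lemma bounded_integrable X (M : R) : measurable_fun setT X ->
  (forall w, `|X w| <= M) -> P.-integrable setT (EFin \o X).
Proof.
move=> mX XM; apply: measurable_bounded_integrable => //.
  by rewrite -ge0_fin_numE// fin_num_measure.
exists M; split; first exact: num_real.
by move=> r Mr w _ /=; rewrite (le_trans (XM w))// ltW.
Qed.

Lemma Rintegral_prob_cst (c : R) : Rintegral P setT (fun _ => c) = c.
Proof. 
rewrite Rintegral_cst// -[RHS]mulr1; congr (c * _).
exact: (congr1 fine (probability_setT P)). Qed.

(** Inverting exp(-y) >= 1 - y gives exp y <= 1/(1 - y), and (1 - y)(1 + y + 2y^2) = 1 + y^2 (1 -
    2y) >= 1. *)
Lemma expR_le_quad (y : R) : y <= 2^-1 -> expR y <= 1 + y + 2 * y ^+ 2.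
Proof.
move=> y2; have y1 : 0 < 1 - y by lra.
have : expR y <= (1 - y)^-1.
  rewrite -[y in expR y]opprK expRN lef_pV2 ?posrE ?expR_gt0//.
  by have := expR_ge1Dx (- y).
move=> /le_trans; apply; rewrite -[leLHS]mul1r ler_pdivrMr//.
by have := sqr_ge0 y; nra.
Qed.

(** Integrate the quadratic bound for the exponential: the linear term has mean zero, and 1 + x <=
    exp x absorbs the rest. *)
Lemma mgf_bound X (M s : R) : measurable_fun setT X ->
  (forall w, `|X w| <= M) -> Rintegral P setT X = 0 ->
  0 <= s -> s * M <= 2^-1 ->
  Rintegral P setT (fun w => expR (s * X w)) <= expR (2 * (s * M) ^+ 2).
Proof.
move=> mX XM EX s0 sM.
have iX := bounded_integrable mX XM.
have sX w : `|s * X w| <= s * M by rewrite normrM ger0_norm// ler_wpM2l.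
apply: (@le_trans _ _ (Rintegral P setT (fun w => (1 + 2 * (s * M) ^+ 2) + s * X w))).
  apply: le_Rintegral => //.
  - apply: (@bounded_integrable _ (expR (s * M))).
      apply: measurableT_comp; first exact: measurable_expR.
      exact: measurable_funM.
    by move=> w; rewrite gtr0_norm ?expR_gt0// ler_expR (le_trans (ler_norm _)).
  - apply: (@bounded_integrable _ (1 + 2 * (s * M) ^+ 2 + s * M)).
      by apply: measurable_funD => //; exact: measurable_funM.
    move=> w; rewrite (le_trans (ler_normD _ _))// lerD// ger0_norm//.
    by rewrite addr_ge0// mulr_ge0// sqr_ge0.
  - move=> w _; rewrite (le_trans (expR_le_quad _))//.
      by rewrite (le_trans (ler_norm _))// (le_trans (sX w)).
    rewrite addrAC lerD2r lerD2l ler_pM2l// -(real_normK (num_real (s * X w))).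
    by rewrite ler_pXn2r ?nnegrE// (le_trans _ (sX w)).
rewrite RintegralD//; last 2 first.
- by apply: (@bounded_integrable _ `|1 + 2 * (s * M) ^+ 2|).
- apply: (@bounded_integrable _ (s * M)) => //; exact: measurable_funM.
by rewrite RintegralZl// EX mulr0 addr0 Rintegral_prob_cst expR_ge1Dx.
Qed.

(** Markov's inequality for exp(Y - a), which dominates the indicator of the event. The upper bound
    [B] makes the exponentials integrable. *)
Lemma chernoff_bound Y (B a : R) : measurable_fun setT Y ->
  (forall w, Y w <= B) ->
  (P [set w | (a <= Y w)%R] <= (Rintegral P setT (fun w => expR (Y w)) * expR (- a))%:E)%E.
Proof.
move=> mY YB.
have mA : measurable [set w | (a <= Y w)%R].
  rewrite [X in measurable X](_ : _ = setT `&` [set w | (cst a w <= Y w)%R]).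
    exact: measurable_fun_le.
  by rewrite setTI.
have ie : P.-integrable setT (EFin \o (fun w => expR (Y w - a))).
  apply: (@bounded_integrable _ (expR (B - a))).
    apply: measurableT_comp; first exact: measurable_expR.
    exact: measurable_funB.
  by move=> w; rewrite gtr0_norm ?expR_gt0// ler_expR lerD2r.
have iY : P.-integrable setT (EFin \o (fun w => expR (Y w))).
  apply: (@bounded_integrable _ (expR B)).
    by apply: measurableT_comp; first exact: measurable_expR.
  by move=> w; rewrite gtr0_norm ?expR_gt0// ler_expR.
rewrite -(setIT [set w | (a <= Y w)%R]) -integral_indic//.
rewrite -RintegralZr//.
under [X in (_ <= (X)%:E)%E]eq_Rintegral do rewrite -expRD.
rewrite /Rintegral fineK ?integrable_fin_num//.
apply: ge0_le_integral => //.
- by apply/measurable_EFinP; exact: measurable_indic.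
- by case/integrableP: ie.
move=> w _; rewrite lee_fin indicE.
case: (boolP (w \in _)) => [/set_mem/= aY|_]; last exact: expR_ge0.
by rewrite -expR0 ler_expR subr_ge0.
Qed.

Lemma nneseries_inv_sqr (u : nat -> \bar R) : (forall k, (0 <= u k)%E) ->
  (forall k, (u k <= (k.+1%:R ^- 2)%:E)%E) -> (\sum_(k <oo) u k < +oo)%E.
Proof.
move=> u0 u1; apply: (@le_lt_trans _ _ 2%:E); last exact: ltry.
apply: lime_le; first exact: is_cvg_nneseries.
apply: nearW => n.
(* With x = n + 1, passing from [n] to n + 1 raises this bound by 2/(x(x + 1)), which is at least
   1/x^2 because x >= 1. *)
suff : (\sum_(0 <= k < n) u k <= (2 - 2 / n.+1%:R)%:E)%E.
  move=> /le_trans; apply; rewrite lee_fin gerBl.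
  by rewrite divr_ge0.
elim: n => [|n IH]; first by rewrite big_nil divr1 subrr.
rewrite big_nat_recr//=; apply: (le_trans (leeD IH (u1 n))).
rewrite -EFinD lee_fin.
have n0 : (0 : R) < n.+1%:R by rewrite ltr0n.
have -> : n.+2%:R = n.+1%:R + 1 :> R by rewrite natr1.
set x := n.+1%:R in n0 *.
have x1 : 1 <= x by rewrite /x ler1n.
rewrite -subr_ge0.
have -> : 2 - 2 / (x + 1) - (2 - 2 / x + x ^- 2) = (x - 1) / (x ^+ 2 * (x + 1)).
  by field; rewrite !gt_eqF//; lra.
rewrite divr_ge0 ?subr_ge0// mulr_ge0 ?sqr_ge0//; lra.
Qed.

Variables (X : nat -> Omega -> R) (M : R).
Hypotheses (M_gt0 : 0 < M) (mX : forall t, measurable_fun setT (X t))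
  (XM : forall t w, `|X t w| <= M) (EX : forall t, Rintegral P setT (X t) = 0).
Hypothesis mgf_prod : forall T s,
  Rintegral P setT (fun w => expR (\sum_(t < T) s * X t w)) =
  \prod_(t < T) Rintegral P setT (fun w => expR (s * X t w)).

(** Write L = ln T. The Chernoff bound is taken at s = sqrt(L/T)/(2M), where L <= T ensures s M <=
    1/2. The threshold multiplied by [s] is 4L, while the moment generating function of the sum is
    at most exp(L/2) <= exp(2L). What remains is exp(-2L) = T^-2, which is summable. *)
Lemma partial_sum_tail (k : nat) (T := k.+1) :
  (P [set w | (Num.sqrt (T%:R * ln T%:R) * (8 * M) <= \sum_(t < T) X t w)%R]
   <= (T%:R ^- 2)%:E)%E.
Proof.
have T0 : (0 : R) < T%:R by rewrite ltr0n.
have L0 : (0 : R) <= ln T%:R by rewrite ln_ge0// ler1n.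
have LT : ln T%:R <= T%:R :> R by rewrite ltW// ln_sublinear.
set L := ln T%:R in L0 LT *.
pose r := Num.sqrt (L / T%:R); pose s := r / (2 * M).
have r0 : 0 <= r by exact: sqrtr_ge0.
have s0 : 0 <= s by rewrite divr_ge0// mulr_ge0// ltW.
have sM : s * M = r / 2 by rewrite /s; field; rewrite gt_eqF.
have r1 : r <= 1 by rewrite -sqrtr1 ler_sqrt// ler_pdivrMr// mul1r.
have r2 : r ^+ 2 = L / T%:R by rewrite sqr_sqrtr// divr_ge0// ltW.
pose Y w := \sum_(t < T) s * X t w.
pose a := 4 * L.
have sub : [set w | (Num.sqrt (T%:R * L) * (8 * M) <= \sum_(t < T) X t w)%R]
    `<=` [set w | (a <= Y w)%R].
  move=> w /= /(ler_wpM2l s0); rewrite /Y -mulr_sumr; apply: le_trans.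
  have -> : s * (Num.sqrt (T%:R * L) * (8 * M)) = 4 * (r * Num.sqrt (T%:R * L)).
    by rewrite /s; field; rewrite gt_eqF.
  rewrite -sqrtrM; last by rewrite divr_ge0// ltW.
  have -> : L / T%:R * (T%:R * L) = L ^+ 2 by field; rewrite gt_eqF.
  by rewrite sqrtr_sqr ger0_norm// /a lexx.
have mY : measurable_fun setT Y.
  by apply: measurable_sum => t; apply: measurable_funM.
have YB w : Y w <= \sum_(t < T) s * M.
  by apply: ler_sum => t _; rewrite ler_wpM2l// (le_trans (ler_norm _)).
have mA (c : R) (Z : Omega -> R) : measurable_fun setT Z -> measurable [set w | (c <= Z w)%R].
  move=> mZ; rewrite [X in measurable X](_ : _ = setT `&` [set w | (cst c w <= Z w)%R]).
    exact: measurable_fun_le.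
  by rewrite setTI.
apply: (@le_trans _ _ (P [set w | (a <= Y w)%R])).
  by apply: le_measure; rewrite ?inE//; apply: mA => //; exact: measurable_sum.
apply: (le_trans (chernoff_bound a mY YB)); rewrite lee_fin.
have -> : T%:R ^- 2 = expR (2 * L) * expR (- a) :> R.
  rewrite -expRD /a (_ : 2 * L + - (4 * L) = - (2 * L)); last by lra.
  by rewrite expRN mulr_natl mulr2n expRD lnK ?posrE// expr2.
rewrite ler_wpM2r ?expR_ge0// mgf_prod.
apply: (@le_trans _ _ (\prod_(t < T) expR (2 * (s * M) ^+ 2))).
  apply: ler_prod => t _; apply/andP; split.
    by apply: Rintegral_ge0 => w _; exact: expR_ge0.
  by apply: mgf_bound => //; rewrite sM; lra.
rewrite prodr_const card_ord -expRM_natl ler_expR sM.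
have -> : T%:R * (2 * (r / 2) ^+ 2) = T%:R * r ^+ 2 / 2 by field.
by rewrite r2 mulrCA divff ?gt_eqF// mulr1; lra.
Qed.

(** Borel-Cantelli: the tail probabilities are summable, so the limsup of the events [F k] is null.
    [F k] concerns the sum of k + 1 terms, which leaves out the empty sum. *)
Lemma partial_sum_ae : {ae P, forall w, \forall T \near \oo,
  \sum_(t < T) X t w <= Num.sqrt (T%:R * ln T%:R) * (8 * M)}.
Proof.
pose F k := [set w | (Num.sqrt (k.+1%:R * ln k.+1%:R) * (8 * M) <=
  \sum_(t < k.+1) X t w)%R].
have mF k : measurable (F k).
  rewrite [X in measurable X](_ : _ = setT `&`
      [set w | (cst (Num.sqrt (k.+1%:R * ln k.+1%:R) * (8 * M)) w
        <= \sum_(t < k.+1) X t w)%R]); last by rewrite setTI.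
  by apply: measurable_fun_le => //; exact: measurable_sum.
exists (lim_sup_set F); split.
- by apply: bigcapT_measurable => n; apply: bigcup_measurable.
- apply: lim_sup_set_cvg0 => //; apply: nneseries_inv_sqr => // k.
  exact: partial_sum_tail.
move=> w /= nw n _; apply: contrapT => nF; apply: nw.
exists n.+1 => // -[//|k] /= nk; rewrite leNgt; apply/negP => /ltW Fk.
by apply: nF; exists k.
Qed.

End BoundedRandomVariables.

(** The one-sided bound is applied to [X] and to its negative. The factorisation for the negative at
    [s] is the one for [X] at [- s]. *)
Lemma abs_partial_sum_ae {R : realType} {dO : measure_display}
    {Omega : measurableType dO} (P : probability Omega R)
    (X : nat -> Omega -> R) (M : R) :
  0 < M -> (forall t, measurable_fun setT (X t)) ->
  (forall t w, `|X t w| <= M) -> (forall t, Rintegral P setT (X t) = 0) ->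
  (forall T s, Rintegral P setT (fun w => expR (\sum_(t < T) s * X t w)) =
    \prod_(t < T) Rintegral P setT (fun w => expR (s * X t w))) ->
  {ae P, forall w, \forall T \near \oo,
    `|\sum_(t < T) X t w| <= Num.sqrt (T%:R * ln T%:R) * (8 * M)}.
Proof.
move=> M0 mX XM EX EP.
have up := partial_sum_ae M0 mX XM EX EP.
have lo : {ae P, forall w, \forall T \near \oo,
    \sum_(t < T) - X t w <= Num.sqrt (T%:R * ln T%:R) * (8 * M)}.
  apply: (@partial_sum_ae _ _ _ P (fun t w => - X t w)) => //.
  - by move=> t; apply: measurable_funN.
  - by move=> t w; rewrite normrN.
  - move=> t; under eq_Rintegral do rewrite -mulN1r.
    by rewrite RintegralZl ?EX ?mulr0//; exact: bounded_integrable (XM t).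
  - move=> T s; under eq_Rintegral do under eq_bigr do rewrite mulrN -mulNr.
    rewrite EP; apply: eq_bigr => t _.
    by under [RHS]eq_Rintegral do rewrite mulrN -mulNr.
apply: filterS2 up lo => w uw lw; near=> T.
rewrite ler_norml lerNl -sumrN; apply/andP; split; near: T; [exact: lw|exact: uw].
Unshelve. all: by end_near. Qed.

(** * The group of rotations *)

Section Rotations.
Variables (R : realType) (k : nat).
Implicit Types U V : 'M[R]_k.

Lemma isSO1 : isSO (1%:M : 'M[R]_k).
Proof. by rewrite /isSO trmx1 mulmx1 det1. Qed.

Lemma isSO_mul U V : isSO U -> isSO V -> isSO (U *m V).
Proof.
move=> [UU dU] [VV dV]; split; last by rewrite det_mulmx dU dV mulr1.
by rewrite trmx_mul mulmxA -(mulmxA V^T) UU mulmx1.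
Qed.

Lemma isSO_tr U : isSO U -> isSO U^T.
Proof. by move=> [UU dU]; split; [rewrite trmxK; exact: mulmx1C|rewrite det_tr]. Qed.

Lemma isSO_le1 U i j : isSO U -> `|U i j| <= 1.
Proof.
move=> [UU _]; apply: (sum_sqr1_le1 (x := fun l => U l j)).
have := congr1 (fun A : 'M[R]_k => A j j) UU; rewrite !mxE eqxx mulr1n => <-.
by apply: eq_bigr => l _; rewrite mxE expr2.
Qed.

End Rotations.

(** * Expectations of polynomials in independent Haar rotations *)

Section HaarRotations.
Context {R : realType} {dO : measure_display} {Omega : measurableType dO}.
Variables (P : probability Omega R) (d : nat) (Q : nat -> Omega -> 'M[R]_(d.+1)).
Hypotheses
  (HQmeas : forall t (i j : 'I_d.+1),
     measurable_fun setT (fun w => Q t w i j))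
  (HQSO : forall t w, isSO (Q t w))
  (HQhaar : forall t (g : 'M[R]_(d.+1) -> R) (U : 'M[R]_(d.+1)),
     continuous g -> (exists M : R, forall x, `|g x| <= M) -> isSO U ->
     Rintegral P setT (fun w => g (U *m Q t w)) =
     Rintegral P setT (fun w => g (Q t w)))
  (HQindep : forall k (g : 'I_k -> 'M[R]_(d.+1) -> R),
     (forall i, continuous (g i) /\ exists M : R, forall x, `|g i x| <= M) ->
     Rintegral P setT (fun w => \prod_(i < k) g i (Q i w)) =
     \prod_(i < k) Rintegral P setT (fun w => g i (Q i w))).
Implicit Types (f : 'M[R]_(d.+1) -> R) (F G : 'M[R]_(d.+1) -> R[i]).

(** The invariance and independence hypotheses speak of functions that are continuous and bounded on
    all matrices, whereas a polynomial is in general bounded only on the rotations. Truncation at a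
    bound valid there makes it admissible and leaves its values on rotations unchanged. *)
Definition clip (M x : R) := Num.min M (Num.max (- M) x).

Lemma clip_id M x : `|x| <= M -> clip M x = x.
Proof. by rewrite ler_norml => /andP[a b]; rewrite /clip max_r// min_r. Qed.

Lemma clip_le M x : 0 <= M -> `|clip M x| <= M.
Proof.
move=> M0; rewrite ler_norml /clip ge_min lexx/= andbT.
by rewrite le_min le_max lexx/= andbT; lra.
Qed.

Lemma clip_continuous M : continuous (clip M).
Proof.
move=> x; apply: continuous_min; first exact: cst_continuous.
by apply: continuous_max; [exact: cst_continuous|exact: id].
Qed.

Lemma rpoly_clip f : rpoly f -> exists2 M : R, 0 < M &
  [/\ continuous (clip M \o f), forall x, `|clip M (f x)| <= M,
     forall U, isSO U -> clip M (f U) = f U & forall U, isSO U -> `|f U| <= M].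
Proof.
move=> hf; have [M M0 HM] := rpoly_bounded hf; exists M => //.
have fM U : isSO U -> `|f U| <= M by move=> HU; apply: HM => i j; exact: isSO_le1.
split=> //.
- move=> x; apply: continuous_comp; first exact: rpoly_continuous.
  exact: clip_continuous.
- by move=> x; apply: clip_le; exact: ltW.
- by move=> U HU; rewrite clip_id ?fM.
Qed.

Lemma rpoly_integrable t f : rpoly f -> P.-integrable setT (EFin \o (fun w => f (Q t w))).
Proof.
move=> hf; have [M M0 [_ _ _ fM]] := rpoly_clip hf.
apply: (@bounded_integrable _ _ _ P _ M); first exact: rpoly_measurable.
by move=> w; exact: fM.
Qed.

Lemma rpoly_haar t f U : rpoly f -> isSO U ->
  Rintegral P setT (fun w => f (U *m Q t w)) = Rintegral P setT (fun w => f (Q t w)).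
Proof.
move=> hf HU; have [M M0 [cf bf fE _]] := rpoly_clip hf.
transitivity (Rintegral P setT (fun w => clip M (f (U *m Q t w)))).
  by apply: eq_Rintegral => w _; rewrite fE//; exact: isSO_mul.
rewrite (HQhaar t cf (ex_intro _ M bf) HU).
by apply: eq_Rintegral => w _; rewrite /= fE.
Qed.

Lemma rpoly_sums_ae f : rpoly f ->
  (forall t, Rintegral P setT (fun w => f (Q t w)) = 0) ->
  exists C : R, {ae P, forall w, \forall T \near \oo,
    `|\sum_(t < T) f (Q t w)| <= Num.sqrt (T%:R * ln T%:R) * C}.
Proof.
move=> hf Ef; have [M M0 [cf bf fE fM]] := rpoly_clip hf.
exists (8 * M); apply: (@abs_partial_sum_ae _ _ _ P (fun t w => f (Q t w))) => //.
- by move=> t; exact: rpoly_measurable.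
- by move=> t w; exact: fM.
move=> T s.
transitivity (Rintegral P setT (fun w => \prod_(t < T) expR (s * clip M (f (Q t w))))).
  apply: eq_Rintegral => w _; rewrite -expR_sum; congr expR.
  by apply: eq_bigr => t _; rewrite fE.
transitivity (\prod_(t < T) Rintegral P setT (fun w => expR (s * clip M (f (Q t w))))).
  have := @HQindep T (fun (_ : 'I_T) x => expR (s * clip M (f x))).
  apply=> i; split; last first.
    exists (expR (`|s| * M)) => x; rewrite ger0_norm ?expR_ge0// ler_expR.
    by rewrite (le_trans (ler_norm _))// normrM ler_wpM2l// bf.
  move=> x; apply: (@continuous_comp _ _ _ (fun x => s * clip M (f x)) expR).
    by apply: continuousM; [exact: cst_continuous|exact: cf].
  exact: continuous_expR.
by apply: eq_bigr => t _; apply: eq_Rintegral => w _; rewrite fE.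
Qed.

Definition cE t F : R[i] :=
  Complex (Rintegral P setT (fun w => complex.Re (F (Q t w))))
          (Rintegral P setT (fun w => complex.Im (F (Q t w)))).

Lemma cE_ext t F G : (forall U, isSO U -> F U = G U) -> cE t F = cE t G.
Proof.
by move=> FG; rewrite /cE; congr Complex; apply: eq_Rintegral => w _; rewrite FG.
Qed.

Lemma cE_cst t z : cE t (fun=> z) = z.
Proof. by case: z => a b; rewrite /cE/= !Rintegral_prob_cst. Qed.

Lemma cE_add t F G : cpoly F -> cpoly G ->
  cE t (fun X => F X + G X) = cE t F + cE t G.
Proof.
move=> [rF iF] [rG iG]; apply: complex_ext; rewrite ?Re_add ?Im_add /=.
  under eq_Rintegral do rewrite Re_add.
  by rewrite RintegralD//; exact: (@rpoly_integrable t (fun X => complex.Re (_ X))).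
under eq_Rintegral do rewrite Im_add.
by rewrite RintegralD//; exact: (@rpoly_integrable t (fun X => complex.Im (_ X))).
Qed.

Lemma cE_scale t z F : cpoly F -> cE t (fun X => z * F X) = z * cE t F.
Proof.
move=> [/(rpoly_integrable t) rF /(rpoly_integrable t) iF].
have iZ c (g : Omega -> R) : P.-integrable setT (EFin \o g) ->
    P.-integrable setT (EFin \o (fun w => c * g w)).
  by move=> ig; exact: (integrableZl measurableT c ig).
apply: complex_ext; rewrite ?Re_mul ?Im_mul /=.
  under eq_Rintegral do rewrite Re_mul.
  rewrite RintegralB//; last 2 first.
  - exact: (iZ (complex.Re z) _ rF).
  - exact: (iZ (complex.Im z) _ iF).
  by rewrite !RintegralZl.
under eq_Rintegral do rewrite Im_mul.
rewrite RintegralD//; last 2 first.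
- exact: (iZ (complex.Re z) _ iF).
- exact: (iZ (complex.Im z) _ rF).
by rewrite !RintegralZl.
Qed.

Lemma cE_sum t n (z : 'I_n -> R[i]) (F : 'I_n -> 'M[R]_(d.+1) -> R[i]) :
  (forall i, cpoly (F i)) ->
  cE t (fun X => \sum_i z i * F i X) = \sum_i z i * cE t (F i).
Proof.
move=> HF; have HzF i : cpoly (fun X => z i * F i X).
  by apply: cpoly_mul => //; exact: cpoly_cst.
have : forall r : seq 'I_n, cE t (fun X => \sum_(i <- r) z i * F i X) =
    \sum_(i <- r) z i * cE t (F i).
  elim=> [|i r IH].
    by rewrite big_nil -[RHS](cE_cst t); apply: cE_ext => U _; rewrite big_nil.
  rewrite big_cons -IH -cE_scale// -cE_add//; last exact: cpoly_sum.
  by apply: cE_ext => U _; rewrite big_cons.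
exact.
Qed.

Lemma cE_haar t F U : cpoly F -> isSO U -> cE t (fun X => F (U *m X)) = cE t F.
Proof.
move=> [rF iF] HU; rewrite /cE; congr Complex.
  exact: (rpoly_haar t rF HU).
exact: (rpoly_haar t iF HU).
Qed.

Definition mE t (a b : nat) (W : 'M[R]_(d.+1) -> 'M[R[i]]_(a, b)) : 'M[R[i]]_(a, b) :=
  \matrix_(i, j) cE t (fun X => W X i j).

Definition mpoly_fun (a b : nat) (W : 'M[R]_(d.+1) -> 'M[R[i]]_(a, b)) :=
  forall i j, cpoly (fun X => W X i j).

Lemma mE_ext t a b (W W' : 'M[R]_(d.+1) -> 'M[R[i]]_(a, b)) :
  (forall U, isSO U -> W U = W' U) -> mE t W = mE t W'.
Proof.
by move=> WW'; apply/matrixP => i j; rewrite !mxE; apply: cE_ext => U HU; rewrite WW'.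
Qed.

Lemma mE_cst t a b (B : 'M[R[i]]_(a, b)) : mE t (fun=> B) = B.
Proof. by apply/matrixP => i j; rewrite !mxE cE_cst. Qed.

Lemma mE_mull t a b c (B : 'M[R[i]]_(c, a)) (W : 'M[R]_(d.+1) -> 'M[R[i]]_(a, b)) :
  mpoly_fun W -> mE t (fun X => B *m W X) = B *m mE t W.
Proof.
move=> HW; apply/matrixP => i j; rewrite !mxE.
under [RHS]eq_bigr do rewrite mxE.
by rewrite -cE_sum//; apply: cE_ext => U _; rewrite mxE.
Qed.

Lemma mE_mulr t a b c (W : 'M[R]_(d.+1) -> 'M[R[i]]_(a, b)) (B : 'M[R[i]]_(b, c)) :
  mpoly_fun W -> mE t (fun X => W X *m B) = mE t W *m B.
Proof.
move=> HW; apply/matrixP => i j; rewrite !mxE.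
under [RHS]eq_bigr do rewrite mxE mulrC.
rewrite -cE_sum//; apply: cE_ext => U _; rewrite mxE.
by apply: eq_bigr => l _; rewrite mulrC.
Qed.

Lemma mE_haar t a b (W : 'M[R]_(d.+1) -> 'M[R[i]]_(a, b)) U :
  mpoly_fun W -> isSO U -> mE t (fun X => W (U *m X)) = mE t W.
Proof.
move=> HW HU; apply/matrixP => i j; rewrite !mxE.
exact: (cE_haar t (HW i j) HU).
Qed.

(** Since [W] reverses products, left invariance of the law only shows that the mean absorbs [W V]
    on its right. Transposing the rotation gives a mean that absorbs [W V] on its left, and the two
    means are shown to coincide. *)
Lemma mE_rep_invariant t m (W : 'M[R]_(d.+1) -> 'M[R[i]]_m) U :
  mpoly_fun W -> (forall V V', isSO V -> isSO V' -> W (V *m V') = W V' *m W V) ->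
  isSO U -> W U *m mE t W = mE t W.
Proof.
move=> HW Wmul HU.
have HW' : mpoly_fun (fun X => W X^T).
  move=> i j; apply: (cpoly_comp (HW i j)) => a b.
  apply: (@rpoly_ext _ _ _ (fun X : 'M[R]_d.+1 => X b a)); last exact: rpoly_coord.
  by move=> X; rewrite mxE.
have left V : isSO V -> mE t W *m W V = mE t W.
  move=> HV; rewrite -mE_mulr// -[RHS](mE_haar t HW HV).
  by apply: mE_ext => X HX; rewrite Wmul.
have right V : isSO V -> W V *m mE t (fun X => W X^T) = mE t (fun X => W X^T).
  move=> HV; rewrite -mE_mull// -[RHS](mE_haar t HW' (isSO_tr HV)).
  apply: mE_ext => X HX; rewrite trmx_mul trmxK Wmul//; exact: isSO_tr.
suff -> : mE t W = mE t (fun X => W X^T) by exact: right.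
(* Averaging [left] over transposed rotations writes the first mean as the product of the two means.
   Averaging [right] over rotations writes the second mean as the same product. *)
rewrite -[LHS](mE_cst t) -[RHS](mE_cst t).
rewrite -(mE_ext t (fun V HV => left _ (isSO_tr HV))) mE_mull//.
by rewrite -[RHS](mE_ext t right) mE_mulr// mE_cst.
Qed.

Lemma cpoly_sums_ae m (F : 'I_m -> 'M[R]_(d.+1) -> R[i]) :
  (forall j, cpoly (F j)) -> (forall j t, cE t (F j) = 0) ->
  exists2 C : R, 0 <= C & {ae P, forall w, \forall T \near \oo, forall j : 'I_m,
    `|complex.Re (\sum_(t < T) F j (Q t w))| <= Num.sqrt (T%:R * ln T%:R) * C /\
    `|complex.Im (\sum_(t < T) F j (Q t w))| <= Num.sqrt (T%:R * ln T%:R) * C}.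
Proof.
move=> HF EF.
have bound j : exists C : R, {ae P, forall w, \forall T \near \oo,
    `|complex.Re (\sum_(t < T) F j (Q t w))| <= Num.sqrt (T%:R * ln T%:R) * C /\
    `|complex.Im (\sum_(t < T) F j (Q t w))| <= Num.sqrt (T%:R * ln T%:R) * C}.
  have [rF iF] := HF j.
  have [C1 H1] := rpoly_sums_ae rF (fun t => congr1 (@complex.Re R) (EF j t)).
  have [C2 H2] := rpoly_sums_ae iF (fun t => congr1 (@complex.Im R) (EF j t)).
  exists (Num.max C1 C2); apply: filterS2 H1 H2 => w H1 H2.
  apply: filterS2 H1 H2 => T H1 H2; rewrite Re_sum Im_sum.
  split; [apply: le_trans H1 _|apply: le_trans H2 _];
    by rewrite ler_wpM2l ?sqrtr_ge0// le_max lexx ?orbT.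
have [C HC] := choice bound; exists (\sum_j `|C j|); first exact: sumr_ge0.
have Cle j : C j <= \sum_j `|C j|.
  by rewrite (le_trans (ler_norm _))// (bigD1 j)//= lerDl sumr_ge0.
apply: filterS (filter_forall _ HC) => w Hw.
apply: filterS (filter_forall _ Hw) => T HT j; have [H1 H2] := HT j.
split; [apply: le_trans H1 _|apply: le_trans H2 _];
  by rewrite ler_wpM2l ?sqrtr_ge0.
Qed.

End HaarRotations.

(** * Complex least squares and the passage to the limit *)

Section LeastSquares.
Variable R : realType.

Definition ctr (a b : nat) (B : 'M[R[i]]_(a, b)) : 'M[R[i]]_(b, a) :=
  (map_mx (@conjc R) B)^T.

Lemma ctrM a b c (B : 'M[R[i]]_(a, b)) (D : 'M[R[i]]_(b, c)) :
  ctr (B *m D) = ctr D *m ctr B.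
Proof. by rewrite /ctr map_mxM trmx_mul. Qed.

Lemma ctrK a b (B : 'M[R[i]]_(a, b)) : ctr (ctr B) = B.
Proof. by apply/matrixP => i j; rewrite !mxE conjcK. Qed.

Lemma cabs2E (z : R[i]) : cabs2 z = complex.Re (z^*%C * z).
Proof. by rewrite Re_mul Re_conj Im_conj mulNr opprK -!expr2. Qed.

Lemma cnorm2D n (u v : 'cV[R[i]]_n) :
  cnorm2 (u + v) = cnorm2 u + 2 * complex.Re ((ctr u *m v) 0 0) + cnorm2 v.
Proof.
rewrite mxE Re_sum mulr_sumr -!big_split/=; apply: eq_bigr => i _.
by rewrite /cabs2 !mxE Re_mul Re_conj Im_conj Re_add Im_add; ring.
Qed.

Lemma cabs2_eq0 (z : R[i]) : cabs2 z = 0 -> z = 0.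
Proof.
move/eqP; rewrite paddr_eq0 ?sqr_ge0// !sqrf_eq0 => /andP[/eqP a /eqP b].
exact: complex_ext.
Qed.

Lemma ctr_mul_self_eq0 a b (B : 'M[R[i]]_(a, b)) : ctr B *m B = 0 -> B = 0.
Proof.
move=> BB; apply/matrixP => i j; rewrite mxE; apply: cabs2_eq0.
have := congr1 (fun C : 'M[R[i]]_b => complex.Re (C j j)) BB; rewrite !mxE Re_sum.
under eq_bigr do rewrite !mxE -cabs2E.
move=> /= /eqP; rewrite psumr_eq0 => [/allP/(_ i)|k _]; last exact: cabs2_ge0.
by rewrite mem_index_enum => /(_ isT)/eqP.
Qed.

(** No rank condition is imposed on [B], as it will be the design matrix times a projection. If B^*
    B C = 0 then B C has zero Gram matrix and so vanishes. Hence the row Y^* B lies in the row space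
    of B^* B. *)
Lemma normal_equation a b (B : 'M[R[i]]_(a, b)) (Y : 'cV[R[i]]_a) :
  exists x, ctr (B *m x - Y) *m B = 0.
Proof.
have /submxP[D HD] : (ctr Y *m B <= ctr B *m B)%MS.
  rewrite submxE; set C := cokermx _.
  have BC : B *m C = 0.
    by apply: ctr_mul_self_eq0; rewrite ctrM -mulmxA [X in _ *m X]mulmxA mulmx_coker mulmx0.
  by rewrite -mulmxA BC mulmx0.
exists (ctr D).
have -> : ctr (B *m ctr D - Y) = D *m ctr B - ctr Y.
  by rewrite -[in RHS](ctrK D) -ctrM; apply/matrixP => i j; rewrite !mxE rmorphB.
by rewrite mulmxBl -mulmxA -HD subrr.
Qed.

Lemma cabs_le_cnorm m (v : 'cV[R[i]]_m) j :
  `|complex.Re (v j 0)| <= Num.sqrt (cnorm2 v) /\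
  `|complex.Im (v j 0)| <= Num.sqrt (cnorm2 v).
Proof.
have le : cabs2 (v j 0) <= cnorm2 v.
  by rewrite /cnorm2 (bigD1 j)//= lerDl sumr_ge0// => i _; exact: cabs2_ge0.
by split; rewrite -sqrtr_sqr ler_sqrt ?cnorm2_ge0// (le_trans _ le)//
  /cabs2 ?lerDl ?lerDr sqr_ge0.
Qed.

Lemma Re_pairing_le m (s : 'rV[R[i]]_m) (v : 'cV[R[i]]_m) (b : R) :
  (forall j, `|complex.Re (s 0 j)| <= b /\ `|complex.Im (s 0 j)| <= b) ->
  `|complex.Re ((s *m v) 0 0)| <= 2 * m%:R * b * Num.sqrt (cnorm2 v).
Proof.
move=> Hs; rewrite mxE Re_sum (le_trans (ler_norm_sum _ _ _))//.
apply: (@le_trans _ _ (\sum_(j < m) 2 * b * Num.sqrt (cnorm2 v))); last first.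
  rewrite sumr_const card_ord -[leLHS]mulr_natl le_eqVlt; apply/orP; left.
  by apply/eqP; ring.
apply: ler_sum => j _; have [r i] := Hs j; have [r' i'] := cabs_le_cnorm v j.
rewrite Re_mul (le_trans (ler_normB _ _))// !normrM -mulrA mulr_natl mulr2n.
by apply: lerD; apply: ler_pM.
Qed.

(* The first-order term of the quadratic expansion around [b0] controls the
   minimiser, because all the quadratic parts are uniformly coercive. *)
Lemma minimiser_deviation n m T (D : 'I_T -> 'M[R[i]]_(n, m)) (Y : 'cV[R[i]]_n)
    (b b0 : 'cV[R[i]]_m) (r : 'cV[R[i]]_n) (C s : R) : (0 < T)%N -> 0 <= C ->
  (forall t v, cnorm2 v <= C * cnorm2 (D t *m v)) ->
  (forall t, D t *m b0 - Y = r) ->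
  \sum_t cnorm2 (D t *m b - Y) <= \sum_t cnorm2 (D t *m b0 - Y) ->
  (forall j, `|complex.Re (\sum_t (ctr r *m D t) 0 j)| <= s /\
             `|complex.Im (\sum_t (ctr r *m D t) 0 j)| <= s) ->
  Num.sqrt (cnorm2 (b - b0)) <= 4 * C * m%:R * s / T%:R.
Proof.
have arith (x y z : R) : 2 * x + y <= 0 -> - z <= x -> y <= 2 * z by lra.
move=> T0 C0 coer Hr min Hs; set v := b - b0; set q := Num.sqrt _.
have T0' : (0 : R) < T%:R by rewrite ltr0n.
(* Nonnegativity of [s] is known only through some index [j]. When m = 0 there is none, but then the
   product m s vanishes. *)
have s0 (j : 'I_m) : 0 <= s by have [h _] := Hs j; exact: le_trans h.
have ms0 : 0 <= m%:R * s.
  have [m0|m0] := posnP m; first by rewrite m0 mul0r.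
  by rewrite mulr_ge0// (s0 (Ordinal m0)).
have expand t : cnorm2 (D t *m b - Y) =
    cnorm2 (D t *m b0 - Y) + 2 * complex.Re ((ctr r *m D t *m v) 0 0) + cnorm2 (D t *m v).
  have -> : D t *m b - Y = (D t *m b0 - Y) + D t *m v.
    by rewrite /v mulmxBr addrAC addrCA subrr addr0.
  by rewrite cnorm2D Hr mulmxA.
have lin : \sum_t cnorm2 (D t *m v) <= 2 * (2 * m%:R * s * q).
  have pair : `|complex.Re (((\sum_t ctr r *m D t) *m v) 0 0)| <= 2 * m%:R * s * q.
    by apply: Re_pairing_le => j; rewrite summxE.
  move: min; under eq_bigr do rewrite expand.
  rewrite !big_split/= -mulr_sumr -addrA gerDl => le0.
  move: pair; rewrite mulmx_suml summxE Re_sum ler_norml => /andP[pair _].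
  exact: arith le0 pair.
(* Summing coercivity over [t] gives T q^2 <= 4 C m s q. The claim follows on dividing by [q], with
   q = 0 treated apart. *)
have : T%:R * q ^+ 2 <= C * (2 * (2 * m%:R * s * q)).
  apply: le_trans (ler_wpM2l C0 lin).
  rewrite sqr_sqrtr ?cnorm2_ge0// [leRHS]mulr_sumr.
  apply: (@le_trans _ _ (\sum_(t < T) cnorm2 v)).
    by rewrite sumr_const card_ord -[leRHS]mulr_natl.
  by apply: ler_sum.
have := sqrtr_ge0 (cnorm2 v); rewrite -/q le_eqVlt => /predU1P[<- _|q0].
  by rewrite divr_ge0// -mulrA mulr_ge0// mulr_ge0.
rewrite ler_pdivlMr// => h; rewrite -(ler_pM2r q0) (le_trans _ (le_trans h _))//.
  by rewrite expr2 mulrA (mulrC q).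
by rewrite le_eqVlt; apply/orP; left; apply/eqP; ring.
Qed.

(** The square roots of T and ln T cancel, and the quotient is at most C / (ln T)^eps. *)
Lemma sqrt_ln_rate_cvg0 (e : nat -> R) (C eps : R) : 0 < eps -> 0 <= C ->
  (forall T, 0 <= e T) ->
  (\forall T \near \oo, e T <= C * Num.sqrt (T%:R * ln T%:R) / T%:R) ->
  (fun T => e T * Num.sqrt T%:R / powR (ln T%:R) (2^-1 + eps)) @ \oo --> (0 : R).
Proof.
move=> eps0 C0 e0 He; apply/cvgr0Pnorm_le => z z0.
(* Once ln T >= B, (ln T)^eps is at least C/z + 1. The added 1 keeps [B] positive. *)
pose B := powR (C / z + 1) eps^-1.
near=> T.
have B0 : 0 < B by rewrite powR_gt0// ltr_wpDl// divr_ge0// ltW.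
have TB : expR B <= T%:R by near: T; exact: nbhs_infty_ger.
have T0 : 0 < T%:R :> R by rewrite (lt_le_trans _ TB)// expR_gt0.
have BL : B <= ln T%:R by rewrite -[B]expRK ler_ln ?posrE ?expR_gt0.
have L0 : 0 < ln T%:R :> R by rewrite (lt_le_trans B0).
have eT : e T <= C * Num.sqrt (T%:R * ln T%:R) / T%:R by near: T.
set L := ln T%:R in BL L0 eT *.
have P0 : 0 < L `^ (2^-1 + eps) by rewrite powR_gt0.
rewrite ger0_norm; last by rewrite divr_ge0 ?mulr_ge0 ?sqrtr_ge0// ltW.
rewrite ler_pdivrMr// powRD; last by rewrite (gt_eqF L0) implybT.
rewrite powR12_sqrt ?(ltW L0)//.
have : C <= z * L `^ eps.
  have : B `^ eps <= L `^ eps by rewrite ge0_ler_powR ?nnegrE// ltW.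
  rewrite -powRrM mulVf ?gt_eqF// powRr1 => [h|]; last by rewrite addr_ge0// divr_ge0// ltW.
  by rewrite -ler_pdivrMl// mulrC (le_trans _ h)// lerDl ler01.
move=> /(ler_wpM2r (sqrtr_ge0 L)); rewrite -mulrA [X in z * X]mulrC; apply: le_trans.
apply: (le_trans (ler_wpM2r (sqrtr_ge0 _) eT)).
rewrite sqrtrM ?(ltW T0)// le_eqVlt; apply/orP; left; apply/eqP.
rewrite -[X in _ / X](sqr_sqrtr (ltW T0)); field.
by rewrite gt_eqF// sqrtr_gt0.
Unshelve. all: by end_near. Qed.

End LeastSquares.

(** * The action of rotations on coefficients, seen through the design matrix *)

Section Regression.
Variables (R : realType) (N d K m n : nat).
Variables (phi : 'I_m -> 'M[R]_(N, d.+1) -> R[i])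
  (Rpts : 'I_n -> 'M[R]_(N, d.+1)).
Hypotheses (HphiV : forall j, inV K (phi j))
  (Hspan : forall g, inV K g ->
     exists c : 'I_m -> R[i], forall X, onS X -> g X = \sum_j c j * phi j X)
  (HR : forall i, onS (Rpts i))
  (HA : \rank (\matrix_(i < n, j < m) phi j (Rpts i)) = m).

Lemma basis_cpoly j : exists2 p, cpoly p & forall X, onS X -> phi j X = p X.
Proof. exact: inV_cpoly. Qed.

Lemma designQ_cpoly : exists2 D : 'M[R]_(d.+1) -> 'M[R[i]]_(n, m), mpoly_fun D &
  forall U, isSO U -> designQ phi Rpts U = D U.
Proof.
have [p pp phip] : exists2 p : 'I_m -> 'M[R]_(N, d.+1) -> R[i],
    forall j, cpoly (p j) & forall j X, onS X -> phi j X = p j X.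
  have [p Hp] := choice (fun j => let: ex_intro2 p a b := basis_cpoly j in
    ex_intro (fun p => cpoly p /\ forall X, onS X -> phi j X = p X) p (conj a b)).
  by exists p => j; case: (Hp j).
exists (fun Q => \matrix_(i, j) p j (Defs.rot Q (Rpts i))).
  move=> i j.
  apply: (@cpoly_ext _ _ _ (fun Q => p j (Defs.rot Q (Rpts i)))) => [Q|].
    by rewrite mxE.
  apply: cpoly_comp => // a b.
  apply: (@rpoly_ext _ _ _ (fun Q : 'M[R]_d.+1 => \sum_l Rpts i a l * Q b l)) => [Q|].
    by rewrite mxE; apply: eq_bigr => l _; rewrite mxE.
  by apply: rpoly_sum => l; apply: rpoly_mul; [exact: rpoly_cst|exact: rpoly_coord].
move=> U HU; apply/matrixP => i j; rewrite !mxE phip//; exact: onS_rot.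
Qed.

Let A := \matrix_(i < n, j < m) phi j (Rpts i).
(* [rotmx U] is the matrix of [g |-> g \o rot U] in the basis [phi]; the left
   inverse of [A] recovers it from the sampled values. *)
Let rotmx (U : 'M[R]_(d.+1)) := pinvmx A *m designQ phi Rpts U.

Lemma pinv_designK : pinvmx A *m A = 1%:M.
Proof. by apply: mulVpmx; rewrite /row_full HA. Qed.

Lemma designQ1 : designQ phi Rpts 1%:M = A.
Proof. by apply/matrixP => i j; rewrite !mxE /Defs.rot trmx1 mulmx1. Qed.

(** By rotation stability, [phi j] composed with the rotation [U] expands in the basis with
    coefficients independent of the point of evaluation. Rotations act by precomposition, which
    reverses the order. *)
Lemma designQ_mul U V : isSO U -> isSO V ->
  designQ phi Rpts (U *m V) = designQ phi Rpts V *m rotmx U.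
Proof.
move=> HU HV.
have [c Hc] := choice (fun j => Hspan (inV_rot (HphiV j) HU)).
have fact V' : isSO V' ->
    designQ phi Rpts (U *m V') = designQ phi Rpts V' *m (\matrix_(l, j) c j l).
  move=> HV'; apply/matrixP => i j; rewrite !mxE.
  have -> : Defs.rot (U *m V') (Rpts i) = Defs.rot U (Defs.rot V' (Rpts i)).
    by rewrite /Defs.rot trmx_mul mulmxA.
  rewrite Hc; last exact: onS_rot.
  by apply: eq_bigr => l _; rewrite !mxE mulrC.
rewrite fact// /rotmx.
(* At the identity the formula reads A(U) = A c, and the left inverse of [A] identifies the
   coefficient matrix as [rotmx U]. *)
have := fact _ (isSO1 R d.+1); rewrite mulmx1 designQ1 => ->.
by rewrite (mulmxA (pinvmx A)) pinv_designK mul1mx.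
Qed.

Lemma rotmx_mul U V : isSO U -> isSO V -> rotmx (U *m V) = rotmx V *m rotmx U.
Proof. by move=> HU HV; rewrite [LHS]/rotmx designQ_mul// [LHS]mulmxA. Qed.

Lemma designQE U : isSO U -> designQ phi Rpts U = A *m rotmx U.
Proof.
by move=> HU; rewrite -[U in LHS]mulmx1 designQ_mul ?designQ1//; exact: isSO1.
Qed.

Lemma rotmx_cpoly : exists2 W, mpoly_fun W & forall U, isSO U -> rotmx U = W U.
Proof.
have [D pD DE] := designQ_cpoly; exists (fun U => pinvmx A *m D U).
  move=> i j; apply: (@cpoly_ext _ _ _ (fun U => \sum_l pinvmx A i l * D U l j)).
    by move=> U; rewrite mxE.
  by apply: cpoly_sum => l; apply: cpoly_mul => //; exact: cpoly_cst.
by move=> U HU; rewrite /rotmx DE.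
Qed.

(** [rotmx U^T *m pinvmx A] is a left inverse of the rotated design matrix. On rotations its entries
    agree with polynomials in [U], so they are bounded uniformly. *)
Lemma designQ_coercive : exists2 C : R, 0 <= C & forall U v, isSO U ->
  cnorm2 v <= C * cnorm2 (designQ phi Rpts U *m v).
Proof.
have [W pW WE] := rotmx_cpoly.
have [M M0 HM] : exists2 M : R, 0 <= M & forall ij U, isSO U ->
    cabs2 ((W U^T *m pinvmx A) ij.1 ij.2) <= M.
  apply: choice_bound => -[i j] /=.
  have [|M M0 HM] := @cpoly_bounded _ _ _ (fun U : 'M[R]_d.+1 => \sum_l W U i l * pinvmx A l j).
    by apply: cpoly_sum => l; apply: cpoly_mul => //; exact: cpoly_cst.
  exists M => // U HU; rewrite mxE; apply: HM => a b.
  by apply: isSO_le1; exact: isSO_tr.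
exists (m%:R * (n%:R * M)); first by rewrite !mulr_ge0.
move=> U v HU.
have {1}-> : v = (W U^T *m pinvmx A) *m (designQ phi Rpts U *m v).
  rewrite mulmxA -(mulmxA (W _)) -/(rotmx U) -WE; last exact: isSO_tr.
  rewrite -rotmx_mul//; last exact: isSO_tr.
  case: (isSO_tr HU) => UU _; rewrite trmxK in UU.
  by rewrite UU /rotmx designQ1 pinv_designK mul1mx.
by apply: cnorm2_mulmx_le => i j; exact: (HM (i, j)).
Qed.

(** Rotating the argument replaces the coefficient vector [b] by [rotmx U *m b]. *)
Lemma rot_invariant_combination (b : 'cV[R[i]]_m) :
  (forall U, isSO U -> rotmx U *m b = b) ->
  rot_invariant (fun X => \sum_j b j 0 * phi j X).
Proof.
move=> Hb U X HU HX.
have [c Hc] := choice (fun j => Hspan (inV_rot (HphiV j) HU)).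
have WE : rotmx U = \matrix_(l, j) c j l.
  rewrite /rotmx; have -> : designQ phi Rpts U = A *m (\matrix_(l, j) c j l).
    by apply/matrixP => i j; rewrite !mxE Hc//; apply: eq_bigr => l _; rewrite !mxE mulrC.
  by rewrite mulmxA pinv_designK mul1mx.
under eq_bigr do rewrite Hc// mulr_sumr.
rewrite exchange_big/=; apply: eq_bigr => l _.
have := congr1 (fun w : 'cV[R[i]]_m => w l 0) (Hb _ HU); rewrite WE mxE => <-.
rewrite mulr_suml; apply: eq_bigr => j _.
by rewrite mxE mulrA (mulrC (c j l)).
Qed.

Context {dO : measure_display} {Omega : measurableType dO}.
Variables (P : probability Omega R) (Q : nat -> Omega -> 'M[R]_(d.+1)).
Hypotheses
  (HQmeas : forall t (i j : 'I_d.+1),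
     measurable_fun setT (fun w => Q t w i j))
  (HQSO : forall t w, isSO (Q t w))
  (HQhaar : forall t (g : 'M[R]_(d.+1) -> R) (U : 'M[R]_(d.+1)),
     continuous g -> (exists M : R, forall x, `|g x| <= M) -> isSO U ->
     Rintegral P setT (fun w => g (U *m Q t w)) =
     Rintegral P setT (fun w => g (Q t w))).

(* [b] is the least-squares fit within the rotation-invariant subspace. *)
Lemma invariant_least_squares (Y : 'cV[R[i]]_n) : exists2 b : 'cV[R[i]]_m,
  (forall U, isSO U -> rotmx U *m b = b) &
  forall t, ctr (A *m b - Y) *m mE P Q t (designQ phi Rpts) = 0.
Proof.
have [W pW WE] := rotmx_cpoly.
have inv t U : isSO U -> W U *m mE P Q t W = mE P Q t W.
  move=> HU; apply: (mE_rep_invariant HQmeas HQSO HQhaar) => // V V' HV HV'.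
  by rewrite -!WE ?rotmx_mul//; exact: isSO_mul.
(* The image of the mean of [W] consists of invariant vectors, so the fit among these is a fit with
   design matrix [A *m mE P Q 0 W]. *)
have [x Hx] := normal_equation (A *m mE P Q 0 W) Y.
exists (mE P Q 0 W *m x); first by move=> U HU; rewrite WE// mulmxA inv.
move=> t.
(* Write Pi_t for the mean of W(Q_t). Averaging W(U) Pi_t = Pi_t over the law of Q_0 gives Pi_t =
   Pi_0 Pi_t, so the single normal equation for A Pi_0 serves every [t]. *)
have -> : mE P Q t (designQ phi Rpts) = A *m mE P Q 0 W *m mE P Q t W.
  have -> : mE P Q t (designQ phi Rpts) = A *m mE P Q t W.
    rewrite -mE_mull//; apply: mE_ext => // U HU; rewrite designQE ?WE//.
  rewrite -mulmxA; congr (_ *m _).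
  rewrite -mE_mulr// -[LHS](mE_cst P Q 0); apply: mE_ext => // U HU.
  by rewrite inv.
by rewrite (mulmxA A) [LHS]mulmxA Hx mul0mx.
Qed.

End Regression.

(** * Assembly of the almost sure rate *)

Unset Implicit Arguments.
Set Strict Implicit.
Set Printing Implicit Defensive.

Theorem mainTheorem9
  (R : realType) (N d K m mI n : nat)
  (* orthonormal basis phi_1..phi_m of V_K, phi_1..phi_mI a basis of B_K *)
  (phi : 'I_m -> 'M[R]_(N, d.+1) -> R[i])
  (HphiV : forall j, inV K (phi j))
  (Hortho : forall j k, ip (phi j) (phi k) = (j == k)%:R)
  (Hspan : forall g, inV K g ->
     exists c : 'I_m -> R[i], forall X, onS X -> g X = \sum_j c j * phi j X)
  (HmI : (mI <= m)%N)
  (HphiB : forall j : 'I_m, (j < mI)%N -> rot_invariant (phi j))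
  (HspanB : forall g : 'M[R]_(N, d.+1) -> R[i], inV K g -> rot_invariant g ->
     exists c : 'I_m -> R[i],
       forall X, onS X -> g X = \sum_(j : 'I_m | (j < mI)%N) c j * phi j X)
  (* data *)
  (Rpts : 'I_n -> 'M[R]_(N, d.+1)) (HR : forall i, onS (Rpts i))
  (f : 'M[R]_(N, d.+1) -> R[i]) (Hf : rot_invariant f)
  (* full column rank of A *)
  (HA : \rank (\matrix_(i < n, j < m) phi j (Rpts i)) = m)
  (* i.i.d. Haar rotations on a probability space *)
  (dO : measure_display) (Omega : measurableType dO) (P : probability Omega R)
  (Q : nat -> Omega -> 'M[R]_(d.+1))
  (HQmeas : forall t (i j : 'I_d.+1),
     measurable_fun setT (fun w => Q t w i j))
  (HQSO : forall t w, isSO (Q t w))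
  (HQhaar : forall t (g : 'M[R]_(d.+1) -> R) (U : 'M[R]_(d.+1)),
     continuous g -> (exists M : R, forall x, `|g x| <= M) -> isSO U ->
     Rintegral P setT (fun w => g (U *m Q t w)) =
     Rintegral P setT (fun w => g (Q t w)))
  (HQindep : forall k (g : 'I_k -> 'M[R]_(d.+1) -> R),
     (forall i, continuous (g i) /\ exists M : R, forall x, `|g i x| <= M) ->
     Rintegral P setT (fun w => \prod_(i < k) g i (Q i w)) =
     \prod_(i < k) Rintegral P setT (fun w => g i (Q i w)))
  (* beta_aug^(T): minimisers of L_aug with parameters (1/T, Q_t)_{t=1}^T *)
  (beta : Omega -> nat -> 'cV[R[i]]_m)
  (Hbeta : forall w T, (0 < T)%N -> forall b : 'cV[R[i]]_m,
     Laug phi Rpts (\col_(i < n) f (Rpts i)) (fun _ : 'I_T => (T%:R)^-1)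
          (fun t : 'I_T => Q t w) (beta w T)
     <= Laug phi Rpts (\col_(i < n) f (Rpts i)) (fun _ : 'I_T => (T%:R)^-1)
          (fun t : 'I_T => Q t w) b) :
  forall eps : R, 0 < eps ->
  {ae P, forall w,
    (fun T : nat =>
       eps_sym (fun X => \sum_(j < m) beta w T j 0 * phi j X)
       * Num.sqrt (T%:R) / powR (ln (T%:R)) (2^-1 + eps)) @ \oo --> 0}.
Proof.
move=> eps eps0.
set Y := \col_(i < n) f (Rpts i) in Hbeta.
have [b0 inv0 Horth] := invariant_least_squares HphiV Hspan HR HA HQmeas HQSO HQhaar Y.
set A := \matrix_(i < n, j < m) phi j (Rpts i) in Horth.
set r := A *m b0 - Y in Horth.
have [D pD DE] := designQ_cpoly HphiV HR.
have [C1 C10 coer] := designQ_coercive HphiV Hspan HR HA.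
have [C2 C20 Heps] := eps_sym_le (basis_cpoly HphiV).
(* The entries of the first-order term r^* A(U), written with the polynomial version [D] of the
   design matrix. *)
pose F (j : 'I_m) U := (ctr r *m D U) 0 j.
have FE j U : F j U = \sum_i ctr r 0 i * D U i j by rewrite /F mxE.
have HF j : cpoly (F j).
  apply: cpoly_ext (fun U => esym (FE j U)) _.
  by apply: cpoly_sum => i; apply: cpoly_mul => //; exact: cpoly_cst.
have EF j t : cE P Q t (F j) = 0.
  have := Horth t.
  have -> : mE P Q t (designQ phi Rpts) = mE P Q t D by exact: mE_ext.
  rewrite -mE_mull//.
  by move=> /matrixP/(_ 0 j); rewrite !mxE.
have [C3 C30 Hae] := cpoly_sums_ae HQmeas HQSO HQindep HF EF.
apply: filterS Hae => w Hw.
apply: (@sqrt_ln_rate_cvg0 _ _ (C2 * (4 * C1 * m%:R * C3))) => //.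
- by rewrite !mulr_ge0.
- by move=> T; exact: sqrtr_ge0.
near=> T.
have T0 : (0 < T)%N by near: T; exact: nbhs_infty_gt.
have HT : forall j : 'I_m,
    `|complex.Re (\sum_(t < T) F j (Q t w))| <= Num.sqrt (T%:R * ln T%:R) * C3 /\
    `|complex.Im (\sum_(t < T) F j (Q t w))| <= Num.sqrt (T%:R * ln T%:R) * C3.
  by near: T.
(* An invariant coefficient vector predicts the same values at rotated points, so the residual does
   not depend on the rotation. *)
have res U : isSO U -> D U *m b0 - Y = r.
  by move=> HU; rewrite -DE// (designQE HphiV Hspan HR HA HU) -mulmxA inv0.
apply: (le_trans (Heps _ _ (rot_invariant_combination HphiV Hspan HR HA inv0))).
rewrite -[leRHS]mulrA -[leRHS]mulrA ler_wpM2l//.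
have -> : 4 * C1 * m%:R * C3 * (Num.sqrt (T%:R * ln T%:R) / T%:R) =
  4 * C1 * m%:R * (Num.sqrt (T%:R * ln T%:R) * C3) / T%:R by ring.
apply: (minimiser_deviation (D := fun t : 'I_T => D (Q t w)) (Y := Y) (r := r)) => //.
- by move=> t v; rewrite -DE//; exact: coer.
- by move=> t; exact: res.
(* The common factors 1/2 and 1/T are positive and cancel, leaving the comparison of plain sums of
   squares. *)
- have := Hbeta w T T0 b0; rewrite /Laug -!mulr_sumr.
  rewrite ler_pM2l ?invr_gt0// ler_pM2l ?invr_gt0 ?ltr0n//.
  by under eq_bigr do rewrite DE//; under [X in _ <= X]eq_bigr do rewrite DE//.
Unshelve. all: by end_near. Qed.
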